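(* For online one-sided bipartite matching: for every $\epsilon>0$ there exists a max-of-$n^{O(1)}$ algorithm achieving an approximation ratio of $1-1/e-\epsilon$; and no max-of-$2^{o(n)}$ algorithm can achieve an approximation ratio better than $1-1/e+\epsilon$.
   Context: Online one-sided bipartite matching: the bipartite graph has an offline side, whose vertex names are known in advance, and an online side of vertices arriving one at a time in adversarial order; each online vertex arrives together with its set of offline neighbours, and the algorithm must irrevocably either match it to a currently unmatched neighbour or leave it unmatched. The goal is to maximize the matching size; $n$ is the size of the input (number of online vertices), and the algorithm is allowed to know $n$ (non-uniform). A max-of-$k$ algorithm runs $k$ deterministic online algorithms in parallel, building $k$ matchings, and outputs the largest. The approximation ratio is $\inf_I v(\mathbb{A},I)/v(I)$ with $v(I)$ the maximum matching size. *)

(* Defs.v *)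
From mathcomp Require Import all_boot.
From Stdlib Require Import Reals.

Set Implicit Arguments.
Unset Strict Implicit.
Unset Printing Implicit Defensive.

(* Offline side: the vertex names 'I_m (known in advance).
   An instance with n online vertices: an n-tuple of neighbour sets,
   the i-th entry being the offline neighbourhood of the i-th arriving
   online vertex (arrival order = tuple order). *)
Definition instance (n m : nat) := n.-tuple {set 'I_m}.

(* A deterministic online algorithm (for offline side 'I_m): given the
   sequence of neighbour sets arrived so far (the current one last), it
   proposes an offline vertex to match the current online vertex to, or
   None.  Its own past decisions are a deterministic function of the
   history, so they need not be passed explicitly.  A proposal that is
   not a currently unmatched neighbour is treated as "leave unmatched". *)
Definition online_alg (m : nat) := seq {set 'I_m} -> option 'I_m.

Fixpoint run_aux (m : nat) (A : online_alg m) (past : seq {set 'I_m})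
    (matched : {set 'I_m}) (arr : seq {set 'I_m}) : nat :=
  match arr with
  | [::] => 0
  | N :: rest =>
      let h := rcons past N in
      match A h with
      | Some u =>
          if (u \in N) && (u \notin matched)
          then (run_aux A h (u |: matched) rest).+1
          else run_aux A h matched rest
      | None => run_aux A h matched rest
      end
  end.

Definition run (n m : nat) (A : online_alg m) (I : instance n m) : nat :=
  run_aux A [::] set0 (tval I).

Definition is_matching (n m : nat) (I : instance n m)
    (f : {ffun 'I_n -> option 'I_m}) : bool :=
  [forall i, if f i is Some u then u \in tnth I i else true] &&
  [forall i, forall j, ((f i != None) && (f i == f j)) ==> (i == j)].

Definition msize (n m : nat) (f : {ffun 'I_n -> option 'I_m}) : nat :=
  #|[set i | f i != None]|.

Definition opt (n m : nat) (I : instance n m) : nat :=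
  \max_(f | is_matching I f) msize f.

(* A (non-uniform) max-of-k algorithm: for each input size n (and offline
   vertex set 'I_m), a list of deterministic online algorithms run in
   parallel; the output is the largest of the matchings they build. *)
Definition max_alg := forall n m : nat, seq (online_alg m).

Definition max_value (F : max_alg) (n m : nat) (I : instance n m) : nat :=
  \max_(A <- F n m) run A I.

Definition uses_at_most (F : max_alg) (k : nat -> nat) : Prop :=
  forall n m, size (F n m) <= k n.

Definition achieves_ratio (F : max_alg) (r : R) : Prop :=
  forall n m (I : instance n m),
    (r * INR (opt I) <= INR (max_value F I))%R.

Definition poly_bounded (k : nat -> nat) : Prop :=
  exists C c : nat, forall n, k n <= C * n ^ c.

Definition subexp_bounded (k : nat -> nat) : Prop :=
  forall d : R, (0 < d)%R ->
    exists N : nat, forall n, N <= n -> (INR (k n) <= Rpower 2 (d * INR n))%R.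

(* Main.v *)
(* Upper bound. Ranking with K priority levels per offline vertex has expected
   ratio 1 - (K / (K+1))^K against any fixed instance, by the randomized
   primal-dual argument of Devanur, Jain and Kleinberg. Hence a constant fraction
   of all level assignments is good for any given instance. After renaming the
   offline vertices in order of appearance there are only 2^(O(n^3)) instances of
   size n, so O(n^3) greedily chosen level assignments contain a good one for
   every instance.

   Lower bound. Against a deterministic algorithm, a randomly permuted upper
   triangular instance of constant size N has expected matching size about
   (1 - 1/e) N. Concatenating B such blocks on disjoint offline vertices, each
   permutation can be chosen so that the potential \sum_A z^(run A) over all the
   algorithms A grows by at most its average factor 1 + mu (z^N - 1). Once all
   blocks are placed, this bounds every z^(run A) by the number of algorithms
   times (1 + mu (z^N - 1))^B, where mu is close to 1 - 1/e. *)

Require Import Defs.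
From mathcomp Require Import all_boot all_order all_fingroup all_algebra.
From mathcomp Require Import zify ring lra.

Set Implicit Arguments.
Unset Strict Implicit.
Unset Printing Implicit Defensive.

Import Order.TTheory GRing.Theory Num.Theory.

(** * Optimal matchings *)

Lemma matching_none n m (I : instance n m) : is_matching I [ffun=> None].
Proof.
apply/andP; split; apply/forallP => i; rewrite ?ffunE //.
by apply/forallP => j; rewrite !ffunE.
Qed.

Lemma opt_matching n m (I : instance n m) :
  exists2 f, is_matching I f & opt I = msize f.
Proof.
have [|f fM optE] := @eq_bigmax_cond _ (is_matching I) (@msize n m).
  by apply/card_gt0P; exists [ffun=> None]; apply: matching_none.
by exists f.
Qed.

(** * Ranking with finitely many levels *)

Section Ranking.
Variables (m K : nat).
Implicit Types (s t : {ffun 'I_m -> 'I_K}) (N M : {set 'I_m}).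
Implicit Types (h : seq {set 'I_m}) (u w : 'I_m).

(* Order by level, ties broken by name. *)
Definition rank_key s u : nat := s u * m + u.

Lemma rank_key_inj s : injective (rank_key s).
Proof.
move=> u w /(congr1 (modn^~ m)).
by rewrite !modnMDl !modn_small // => /val_inj.
Qed.

Lemma rank_key_level s u w : rank_key s u <= rank_key s w -> s u <= s w.
Proof.
move=> /(leq_div2r m); have m_gt0 : 0 < m by apply: leq_ltn_trans (ltn_ord u).
by rewrite !divnMDl // !divn_small // !addn0.
Qed.

Definition choose s N M : option 'I_m :=
  if [pick u in N :\: M] is Some u0 then
    Some [arg min_(u < u0 in N :\: M) rank_key s u]
  else None.

Variant choose_spec s N M : option 'I_m -> Prop :=
| ChooseSome u of u \in N & u \notin M
    & (forall w, w \in N -> w \notin M -> rank_key s u <= rank_key s w) :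
    choose_spec s N M (Some u)
| ChooseNone of (forall w, w \in N -> w \in M) : choose_spec s N M None.

Lemma chooseP s N M : choose_spec s N M (choose s N M).
Proof.
rewrite /choose; case: pickP => [u0 u0P | noP].
  case: arg_minnP => // u; rewrite !inE => /andP[uM uN] minu.
  by constructor=> // w wN wM; apply: minu; rewrite !inE wM.
by constructor=> w wN; have := noP w; rewrite !inE wN andbT => /negbFE.
Qed.

Definition rank_step s M N := if choose s N M is Some u then u |: M else M.
Definition rank_state s M h := foldl (rank_step s) M h.
Definition rank_pick s M h i :=
  choose s (nth set0 h i) (rank_state s M (take i h)).

(** An [online_alg] sees only the history, so the set of matched vertices is recomputed by replaying
    all earlier arrivals. *)
Definition rank_alg s : online_alg m := fun h =>
  choose s (last set0 h) (rank_state s set0 (take (size h).-1 h)).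

Lemma rank_algE s h N :
  rank_alg s (rcons h N) = choose s N (rank_state s set0 h).
Proof.
by rewrite /rank_alg last_rcons size_rcons -cats1 take_size_cat.
Qed.

Lemma run_aux_rank s past h :
  run_aux (rank_alg s) past (rank_state s set0 past) h =
  \sum_(i < size h) isSome (rank_pick s (rank_state s set0 past) h i).
Proof.
elim: h past => [|N h IH] past /=; first by rewrite big_ord0.
rewrite big_ord_recl /= rank_algE /rank_pick /=.
have stE : rank_state s set0 (rcons past N)
         = rank_step s (rank_state s set0 past) N.
  by rewrite /rank_state foldl_rcons.
have := IH (rcons past N); rewrite stE /rank_step.
by case: chooseP => [u uN uM _|_] ->; rewrite ?uN ?uM.
Qed.

Lemma run_rank n s (I : instance n m) :
  run (rank_alg s) I = \sum_(i < n) isSome (rank_pick s set0 I i).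
Proof. by rewrite /run (run_aux_rank s [::]) size_tuple. Qed.

Lemma sub_rank_state s M h : M \subset rank_state s M h.
Proof.
elim: h M => [|N h IH] M //=; apply: subset_trans (IH _).
by rewrite /rank_step; case: choose => // u; apply: subsetUr.
Qed.

Lemma rank_state_take s M h i : rank_state s M (take i h) \subset rank_state s M h.
Proof.
by rewrite -{2}(cat_take_drop i h) /rank_state foldl_cat sub_rank_state.
Qed.

Lemma rank_state_pick s M h i u : i < size h ->
  rank_pick s M h i = Some u -> u \in rank_state s M (take i.+1 h).
Proof.
move=> ih pu; rewrite (take_nth set0 ih) /rank_state foldl_rcons.
by rewrite /rank_step; move: pu; rewrite /rank_pick => ->; rewrite setU11.
Qed.

(** A picked vertex lies in every later state and is never picked again, so the picks form a
    matching. *)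
Lemma run_rank_le_opt n s (I : instance n m) : run (rank_alg s) I <= opt I.
Proof.
pose f := [ffun i : 'I_n => rank_pick s set0 I i].
have fP (i j : 'I_n) u : f i = Some u -> f j = Some u -> ~~ (i < j).
  rewrite !ffunE => iu ju; apply/negP => ij.
  have: u \in rank_state s set0 (take i.+1 I).
    by apply: rank_state_pick iu; rewrite size_tuple.
  move=> /(subsetP _ u) uS.
  have : u \in rank_state s set0 (take j I).
    apply: uS; have -> : take i.+1 I = take i.+1 (take j I).
      by rewrite take_takel.
    exact: rank_state_take.
  move: ju; rewrite /rank_pick; case: chooseP => // w _ wM _ [<-].
  by rewrite (negbTE wM).
apply: leq_trans (leq_bigmax_cond f _); last first.
  apply/andP; split; apply/forallP => i.
    rewrite ffunE /rank_pick (tnth_nth set0).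
    by case: chooseP.
  apply/forallP => j; apply/implyP => /andP[]; case E: (f i) => [u|//] _.
  move=> /eqP /esym fj; rewrite -val_eqE eqn_leq.
  by rewrite (leqNgt i) (leqNgt j) (fP _ _ _ fj E) (fP _ _ _ E fj).
rewrite run_rank /msize -sum1_card [X in _ <= X]big_mkcond /=.
by apply: leq_sum => i _; rewrite inE ffunE; case: rank_pick.
Qed.

(** The vertex picked from outside [M] is either already in [M'] or still the minimum among the
    neighbours outside [M']. *)
Lemma rank_step_mono s M M' N :
  M \subset M' -> rank_step s M N \subset rank_step s M' N.
Proof.
move=> sM; rewrite /rank_step; case: (chooseP s N M) => [a aN aM mina|NM].
  case: (chooseP s N M') => [b bN bM' minb|NM'].
    have [aM'|aM'] := boolP (a \in M').
      by apply: subset_trans (subsetUr _ _); rewrite subUset sub1set aM'.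
    suff -> : a = b by apply: setUS.
    have bM : b \notin M by apply: contra bM' => /(subsetP sM).
    by apply: (@rank_key_inj s); apply/eqP; rewrite eqn_leq mina // minb.
  by rewrite subUset sub1set sM NM'.
by case: choose => // b; apply: subset_trans sM (subsetUr _ _).
Qed.

Lemma rank_state_mono s M M' h :
  M \subset M' -> rank_state s M h \subset rank_state s M' h.
Proof. by elim: h M M' => [//|N h IH] M M' /(rank_step_mono s N) /IH. Qed.

Lemma rank_stepU1 s u M N :
  u \notin rank_step s M N -> rank_step s (u |: M) N = u |: rank_step s M N.
Proof.
rewrite /rank_step; case: (chooseP s N M) => [a aN aM mina|NM].
  rewrite !inE negb_or => /andP[ua uM].
  have aM' : a \notin u |: M by rewrite !inE negb_or eq_sym ua.
  case: chooseP => [b bN|/(_ a aN)]; last by rewrite (negbTE aM').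
  rewrite !inE negb_or => /andP[bu bM] minb.
  suff -> : b = a by rewrite setUCA.
  by apply: (@rank_key_inj s); apply/eqP; rewrite eqn_leq mina // minb.
move=> _; case: chooseP => // b bN.
by rewrite !inE negb_or NM // andbF.
Qed.

(** A vertex that stays free to the end never influenced a choice, so deleting it changes nothing
    else. *)
Lemma rank_stateU1 s u M h :
  u \notin rank_state s M h -> rank_state s (u |: M) h = u |: rank_state s M h.
Proof.
elim: h M => [//|N h IH] M /= uM; rewrite -IH // rank_stepU1 //.
by apply: contra uM => /(subsetP (sub_rank_state s _ h)).
Qed.

Lemma choose_agree s t u N M : (forall w, w != u -> s w = t w) -> u \in M ->
  choose s N M = choose t N M.
Proof.
move=> st uM.
have keyE w : w \notin M -> rank_key s w = rank_key t w.
  by move=> wM; rewrite /rank_key st //; apply: contra wM => /eqP ->.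
case: (chooseP s) => [a aN aM mina|NM]; case: chooseP => [b bN bM minb|NM'] //.
- congr Some; apply: (@rank_key_inj s); apply/eqP.
  by rewrite eqn_leq mina //= !keyE // minb.
- by move: aM; rewrite NM'.
- by move: bM; rewrite NM.
Qed.

Lemma rank_state_agree s t u M h : (forall w, w != u -> s w = t w) -> u \in M ->
  rank_state s M h = rank_state t M h.
Proof.
move=> st; elim: h M => [//|N h IH] M uM /=.
rewrite /rank_step -(choose_agree N st uM) IH //.
by case: choose => // a; rewrite inE uM orbT.
Qed.

Definition set_level s u (j : 'I_K) : {ffun 'I_m -> 'I_K} :=
  [ffun w => if w == u then j else s w].

(* The level of the partner of online vertex [i] when offline vertex [u] is
   deleted (deletion is modelled by starting with [u] already matched);
   [K] if [i] then stays unmatched. *)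
Definition critical_level s u h i : nat :=
  if rank_pick s [set u] h i is Some b then s b else K.

Lemma rank_pick_del_set_level s u j h i :
  rank_pick (set_level s u j) [set u] h i = rank_pick s [set u] h i.
Proof.
have st w : w != u -> set_level s u j w = s w.
  by move=> /negbTE wu; rewrite ffunE wu.
rewrite /rank_pick (rank_state_agree _ st) ?set11 //.
by apply: (choose_agree _ st); apply: (subsetP (sub_rank_state _ _ _)); rewrite set11.
Qed.

Lemma critical_level_le s u h i : critical_level s u h i <= K.
Proof. by rewrite /critical_level; case: rank_pick => // b; apply: ltnW. Qed.

(** By monotonicity, restoring [u] at any level only leaves more vertices free: the partner of [i]
    in the run without [u] is still available, so [i] picks at that level or lower. *)
Lemma rank_pick_critical s u j h i : critical_level s u h i < K ->
  exists2 a, rank_pick (set_level s u j) set0 h i = Some a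
           & set_level s u j a <= critical_level s u h i.
Proof.
rewrite /critical_level -(rank_pick_del_set_level s u j).
set t := set_level s u j.
rewrite {1 3}/rank_pick; case: (chooseP t) => [b bN bM minb _|]; last by rewrite ltnn.
have uM : u \in rank_state t [set u] (take i h).
  by apply: (subsetP (sub_rank_state _ _ _)); rewrite set11.
have bu : b != u by apply: contra bM => /eqP ->.
have sM := rank_state_mono t (take i h) (sub0set [set u]).
have bM0 : b \notin rank_state t set0 (take i h).
  by apply: contra bM => /(subsetP sM).
rewrite /rank_pick; case: chooseP => [a aN aM mina|/(_ b bN)]; last first.
  by rewrite (negbTE bM0).
exists a => //; have := rank_key_level (mina b bN bM0).
by rewrite [t b]ffunE (negbTE bu).
Qed.

(** If [u] stayed free, the run without it would be the same elsewhere. The pick [a] of [i],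
    preferred to the free neighbour [u], has level at most [j], which would force the critical level
    down to [j]. *)
Lemma rank_state_critical s u (j : 'I_K) h i :
  i < size h -> u \in nth set0 h i -> j < critical_level s u h i ->
  u \in rank_state (set_level s u j) set0 h.
Proof.
move=> ih uN; rewrite /critical_level -(rank_pick_del_set_level s u j).
set t := set_level s u j => jc; apply/negPn/negP => uS.
have uS1 : u \notin rank_state t set0 (take i.+1 h).
  by apply: contra uS => /(subsetP (rank_state_take _ _ _ _)).
have uS0 : u \notin rank_state t set0 (take i h).
  apply: contra uS1 => uS1; rewrite (take_nth set0 ih) /rank_state foldl_rcons.
  by apply: (subsetP (sub_rank_state t _ [:: nth set0 h i])).
have stE := rank_stateU1 uS0.
rewrite setU0 in stE.
case E: (rank_pick t set0 h i) => [a'|]; last first.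
  by move: E; rewrite /rank_pick; case: chooseP => // /(_ u uN); rewrite (negbTE uS0).
have := rank_state_pick ih E; move: E; rewrite /rank_pick.
case: chooseP => // a aN aM mina [<-] aS1.
have au : a != u by apply: contraNneq uS1 => <-.
have aM' : a \notin rank_state t [set u] (take i h).
  by rewrite stE !inE negb_or au.
have ja := rank_key_level (mina u uN uS0).
move: jc; rewrite /rank_pick.
case: chooseP => [b bN bM minb|/(_ a aN)]; last by rewrite (negbTE aM').
have bu : b != u.
  by apply: contra bM => /eqP ->; rewrite stE setU11.
have := rank_key_level (minb a aN aM').
move: ja; rewrite [t u]ffunE eqxx [t b]ffunE (negbTE bu) => ja sba.
by rewrite ltnNge (leq_trans sba ja).
Qed.

(** * Primal-dual analysis of ranking *)

Section Weights.
Local Open Scope ring_scope.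
Variables (R : realFieldType) (g : nat -> R).
Hypothesis g_ge0 : forall c, (0 <= g c).
Hypothesis g_mono : forall c d, (c <= d)%N -> (g c <= g d).
Hypothesis g_last : g K = 1.
(** Discrete form of [g(c) - g(0) <= \int_0^c g]. It makes the offline gain [\sum_(j < c) g j] and
    the online gain [K (1 - g c)] add up to at least [K (1 - g 0)], whatever the critical level
    [c]. *)
Hypothesis g_sum : forall c, (c <= K)%N -> K%:R * (g c - g 0%N) <= \sum_(j < c) g j.

(* Devanur-Jain-Kleinberg: each matched edge splits its unit of value into
   [g (level)] for the offline end and [1 - g (level)] for the online end. *)
Definition off_share s h u : R := if u \in rank_state s set0 h then g (s u) else 0.
Definition on_share s h i : R :=
  if rank_pick s set0 h i is Some u then 1 - g (s u) else 0.

Lemma sum_rank_state s M h (w : 'I_m -> R) :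
  \sum_(u in rank_state s M h) w u = \sum_(u in M) w u +
  \sum_(i < size h) (if rank_pick s M h i is Some u then w u else 0).
Proof.
elim: h M => [|N h IH] M /=; first by rewrite big_ord0 addr0.
rewrite IH big_ord_recl addrA; congr (_ + _).
rewrite /rank_pick /= /rank_step; case: chooseP => [u uN uM _|]; last by rewrite addr0.
by rewrite big_setU1 //= addrC.
Qed.

Lemma sum_shares n s (I : instance n m) :
  \sum_u off_share s I u + \sum_(i < n) on_share s I i = (run (rank_alg s) I)%:R.
Proof.
rewrite -big_mkcond sum_rank_state big_set0 add0r size_tuple run_rank natr_sum.
rewrite -big_split; apply: eq_bigr => i _ /=; rewrite /on_share.
by case: rank_pick => [u|] /=; rewrite ?addr0 // addrC subrK.
Qed.

Lemma g_le1 (j : 'I_K) : g j <= 1.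
Proof. by rewrite -g_last g_mono // ltnW. Qed.

Lemma off_share_ge0 s h u : 0 <= off_share s h u.
Proof. by rewrite /off_share; case: ifP. Qed.

Lemma on_share_ge0 s h i : 0 <= on_share s h i.
Proof. by rewrite /on_share; case: rank_pick => // u; rewrite subr_ge0 g_le1. Qed.

(** Only the level [j] of [u] varies, so the critical level [c] is fixed. The online end always gets
    at least [1 - g c], and the offline end gets [g j] whenever [j < c]. *)
Lemma edge_share_line s h i u : (i < size h)%N -> u \in nth set0 h i ->
  K%:R * (1 - g 0%N) <=
  \sum_j (off_share (set_level s u j) h u + on_share (set_level s u j) h i).
Proof.
move=> ih uN; set c := critical_level s u h i.
have cK : (c <= K)%N := critical_level_le s u h i.
rewrite big_split /=.
have le_on : K%:R * (1 - g c) <= \sum_j on_share (set_level s u j) h i.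
  rewrite -[K in K%:R]card_ord -sum1_card natr_sum mulr_suml.
  apply: ler_sum => j _; rewrite mul1r.
  have [cltK|Kc] := ltnP c K.
    have [a pa ac] := rank_pick_critical j cltK.
    by rewrite /on_share pa lerB // g_mono.
  (* In the run without [u], [i] is unmatched; the default level [K] has [g K = 1], so nothing is
     claimed for the online end. *)
  have -> : c = K by apply/eqP; rewrite eqn_leq cK.
  by rewrite g_last subrr on_share_ge0.
have le_off : \sum_(j < c) g j <= \sum_j off_share (set_level s u j) h u.
  rewrite (big_ord_widen K (fun j => g j) cK) big_mkcond /=.
  apply: ler_sum => j _; case: ifP => jc; last exact: off_share_ge0.
  by rewrite /off_share (rank_state_critical ih uN jc) ffunE eqxx.
apply: le_trans (lerD le_off le_on).
have := g_sum cK; lra.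
Qed.

(** Exchanging the level of [u] with the spare level [j] is an involution on pairs, so each
    assignment is counted [K] times. *)
Lemma sum_set_level u (F : {ffun 'I_m -> 'I_K} -> R) :
  \sum_s \sum_j F (set_level s u j) = K%:R * \sum_s F s.
Proof.
rewrite pair_big /=.
pose swap (p : {ffun 'I_m -> 'I_K} * 'I_K) := (set_level p.1 u p.2, p.1 u).
have swapK : involutive swap.
  move=> [s j]; rewrite /swap /=; congr pair; last by rewrite ffunE eqxx.
  by apply/ffunP => w; rewrite !ffunE; case: eqP => // ->.
rewrite (reindex_inj (inv_inj swapK)) /=.
rewrite (eq_bigr (fun p => F p.1)); last first.
  by move=> p _; congr F; have := congr1 fst (swapK p).
rewrite -(pair_big predT predT (fun s j => F s)) /= mulr_sumr.
by apply: eq_bigr => s _; rewrite sumr_const card_ord mulr_natl.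
Qed.

Lemma edge_share h i u : (0 < K)%N -> (i < size h)%N -> u \in nth set0 h i ->
  #|{ffun 'I_m -> 'I_K}|%:R * (1 - g 0%N) <=
  \sum_s (off_share s h u + on_share s h i).
Proof.
move=> K0 ih uN.
have K0r : 0 < K%:R :> R by rewrite ltr0n.
rewrite -(ler_pM2l K0r) -(sum_set_level u (fun s => _ + _)).
rewrite mulrCA -sum1_card natr_sum mulr_suml.
by apply: ler_sum => s _; rewrite mul1r; apply: edge_share_line.
Qed.

(** Add up the edge bounds over an optimal matching: its edges are disjoint and shares are
    nonnegative, so the total stays below the value of the run. *)
Lemma sum_run_rank n (I : instance n m) : (0 < K)%N ->
  #|{ffun 'I_m -> 'I_K}|%:R * (1 - g 0%N) * (opt I)%:R <=
  \sum_s (run (rank_alg s) I)%:R.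
Proof.
move=> K0.
have [f fM ->] := opt_matching I.
have /andP[/forallP fN /forallP fI] := fM.
have shares_le s :
    \sum_(i | f i != None) (oapp (off_share s I) 0 (f i) + on_share s I i)
    <= (run (rank_alg s) I)%:R.
  rewrite -sum_shares big_split /=; apply: lerD; last first.
    rewrite big_mkcond; apply: ler_sum => i _.
    by case: ifP => // _; apply: on_share_ge0.
  rewrite (eq_bigr (fun i => \sum_(u | f i == Some u) off_share s I u)); last first.
    move=> i; case: (f i) => // w _ /=.
    by rewrite (eq_bigl (pred1 w)) ?big_pred1_eq // => u /=; rewrite eq_sym.
  rewrite big_mkcond /=.
  rewrite (eq_bigr (fun i => \sum_(u | f i == Some u) off_share s I u)); last first.
    move=> i _; case: ifP => // /negbFE /eqP ->.
    by rewrite big_pred0.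
  rewrite (exchange_big_dep xpredT) //=; apply: ler_sum => u _.
  have [i /eqP iu|no] := pickP [pred i | f i == Some u]; last first.
    by rewrite big_pred0 // off_share_ge0.
  rewrite (big_pred1 i) // => j /=; apply/eqP/eqP => [ju|-> //].
  have /forallP/(_ j) := fI i; rewrite iu ju eqxx /= => /eqP -> //.
apply: le_trans (ler_sum _ (fun s _ => shares_le s)).
rewrite exchange_big /= /msize -sum1_card natr_sum mulr_sumr.
rewrite (eq_bigl (fun i => f i != None)) => [|i]; last by rewrite inE.
apply: ler_sum => i; rewrite mulr1; have := fN i; case: (f i) => // u uN _ /=.
by apply: edge_share; rewrite ?size_tuple // -tnth_nth.
Qed.

End Weights.
End Ranking.

(** * Averaging and greedy covering *)

Section Averaging.
Local Open Scope ring_scope.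
Variable R : realFieldType.

Lemma exists_le_average (S : finType) (F : S -> R) (c : R) : (0 < #|S|)%N ->
  \sum_s F s <= #|S|%:R * c -> exists s, F s <= c.
Proof.
move=> S0 leF; apply/existsP; apply: contraLR leF => /existsPn gtF.
rewrite -ltNge -sum1_card natr_sum mulr_suml; apply: ltr_sum => [|s _].
  by have /card_gt0P[s _] := S0; apply/hasP; exists s; rewrite ?mem_index_enum.
by rewrite mul1r ltNge.
Qed.

(** Each [t] is served by a fraction [p] of [S], so by averaging some [s] serves a fraction [p] of
    the elements still uncovered; each greedy choice multiplies their number by at most [1 - p]. *)
Lemma greedy_cover (S T : finType) (good : S -> T -> bool) (p : R) k :
    (0 < #|S|)%N -> p <= 1 ->
    (forall t, #|S|%:R * p <= #|[set s | good s t]|%:R) ->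
  exists2 l : seq S, size l = k &
    #|[set t | ~~ has (good^~ t) l]|%:R <= (1 - p) ^+ k * #|T|%:R.
Proof.
move=> S0 p1 goodP; elim: k => [|k [l sl lP]].
  by exists [::] => //; rewrite expr0 mul1r ler_nat max_card.
set U := [set t | _] in lP.
have [|s sP] := @exists_le_average S
    (fun s => #|[set t in U | ~~ good s t]|%:R) (#|U|%:R * (1 - p)) S0.
  rewrite (eq_bigr (fun s => \sum_(t in U) (~~ good s t)%:R)); last first.
    move=> s _; rewrite -sum1_card natr_sum [RHS]big_mkcond [LHS]big_mkcond /=.
    by apply: eq_bigr => t _; rewrite inE; case: (t \in U); case: (good _ _).
  rewrite exchange_big /= mulrCA -sum1_card natr_sum mulr_suml.
  apply: ler_sum => t _; rewrite mul1r mulrBr mulr1 lerBrDl.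
  apply: le_trans (lerD (goodP t) (lexx _)) _.
  rewrite -!sum1_card !natr_sum [X in X + _]big_mkcond -big_split /=.
  by apply: ler_sum => s _; rewrite inE; case: (good s t) => /=; rewrite ?addr0 ?add0r.
exists (s :: l); first by rewrite /= sl.
have -> : [set t | ~~ has (good^~ t) (s :: l)] = [set t in U | ~~ good s t].
  by apply/setP => t; rewrite !inE negb_or andbC.
by apply: le_trans sP _; rewrite exprSr mulrAC ler_wpM2r // subr_ge0.
Qed.

End Averaging.

(** * Finitely many instances of each size *)

Section Reduction.
Variables (n m : nat).
Implicit Types (h : seq {set 'I_m}) (N M : {set 'I_m}) (u w : 'I_m).

(* An online vertex with at least [n] neighbours can always be matched, so only
   [n] of its neighbours matter; hence only [n * n] offline vertices matter, and
   they can be named in order of appearance. *)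
Definition shortlist N : seq 'I_m := take n (enum N).
Definition seen h : seq 'I_m := flatten (map shortlist h).
(** At most [n] arrivals show at most [n * n] shortlisted vertices; the extra name keeps the type
    inhabited for [inord]. *)
Definition name h u : 'I_(n * n).+1 := inord (index u (seen h)).
Definition rename h N : {set 'I_(n * n).+1} :=
  [set name h u | u in shortlist N].

Definition lift_alg (B : online_alg (n * n).+1) : online_alg m := fun h =>
  obind (fun x => [pick u in shortlist (last set0 h) | name h u == x])
        (B (map (rename h) h)).

Lemma shortlist_sub N u : u \in shortlist N -> u \in N.
Proof. by move=> /mem_take; rewrite mem_enum. Qed.

Lemma mem_seen h N u : N \in h -> u \in shortlist N -> u \in seen h.
Proof. by move=> Nh uN; apply/flatten_mapP; exists N. Qed.

Lemma seen_cat h h' : seen (h ++ h') = seen h ++ seen h'.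
Proof. by rewrite /seen map_cat flatten_cat. Qed.

Lemma size_seen h : size h <= n -> size (seen h) <= n * n.
Proof.
move=> hn; apply: leq_trans (leq_mul hn (leqnn n)).
elim: h {hn} => [//|N h IH]; rewrite /seen /= size_cat mulSn leq_add //.
by rewrite size_take_min geq_minl.
Qed.

Lemma name_cat h h' u : u \in seen h -> name (h ++ h') u = name h u.
Proof. by move=> uh; rewrite /name seen_cat index_cat uh. Qed.

Lemma rename_cat h h' N : N \in h -> rename (h ++ h') N = rename h N.
Proof.
by move=> Nh; apply: eq_in_imset => u uN; apply/name_cat/(mem_seen Nh).
Qed.

Lemma name_inj h : size h <= n -> {in seen h &, injective (name h)}.
Proof.
move=> /size_seen hn u w us ws /(congr1 val) /=.
have lt_index v : v \in seen h -> index v (seen h) < (n * n).+1.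
  by move=> vs; rewrite ltnS (leq_trans _ hn) // ltnW // index_mem.
rewrite !inordK ?lt_index // => /(congr1 (nth u (seen h))).
by rewrite !nth_index.
Qed.

(** Names never change once given, so renaming by the current history agrees with renaming by the
    full one. They are injective on seen vertices, so the image of [M] is exactly the matched set of
    the renamed run. *)
Lemma run_aux_lift B past M h : size (past ++ h) <= n ->
  M \subset seen (past ++ h) ->
  run_aux (lift_alg B) past M h =
  run_aux B (map (rename (past ++ h)) past) [set name (past ++ h) u | u in M]
    (map (rename (past ++ h)) h).
Proof.
elim: h past M => [//|N h IH] past M sz Ms /=.
move: sz Ms IH; rewrite -cat_rcons; set full := rcons past N ++ h => sz Ms IH.
have histE : map (rename full) (rcons past N)
           = rcons (map (rename full) past) (rename full N) by rewrite map_rcons.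
rewrite -histE {1}/lift_alg.
have -> : map (rename (rcons past N)) (rcons past N)
        = map (rename full) (rcons past N).
  by apply/eq_in_map => N' N'p; rewrite rename_cat.
have Nfull u : u \in shortlist N -> u \in seen full.
  by apply: mem_seen; rewrite /full mem_cat mem_rcons mem_head.
have nameE u : u \in shortlist N -> name (rcons past N) u = name full u.
  by move=> uN; rewrite name_cat // (mem_seen _ uN) // mem_rcons mem_head.
case: (B _) => [x|] /=; last exact: IH.
rewrite last_rcons; case: pickP => [u /andP[uN /eqP]|noU].
  rewrite nameE // => <-; rewrite (shortlist_sub uN).
  rewrite [name full u \in rename full N]imset_f //=.
  have -> : (name full u \in [set name full w | w in M]) = (u \in M).
    apply/imsetP/idP => [[w wM]|uM]; last by exists u.
    by move=> /(name_inj sz) -> //; [apply: Nfull | apply: (subsetP Ms)].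
  case: ifP => _; last exact: IH.
  rewrite IH //; last first.
    by apply/subsetP => w; rewrite !inE => /orP[/eqP ->|/(subsetP Ms)//]; apply: Nfull.
  by rewrite imsetU1.
(* A proposal naming no shortlisted neighbour is rejected in both runs. *)
have -> : (x \in rename full N) = false.
  apply/negbTE/imsetP => -[u uN xE].
  by have := noU u; rewrite uN nameE // xE eqxx.
exact: IH.
Qed.

Definition rename_instance (I : instance n m) : instance n (n * n).+1 :=
  map_tuple (rename I) I.

Lemma run_lift B (I : instance n m) :
  run (lift_alg B) I = run B (rename_instance I).
Proof.
rewrite /run run_aux_lift /= ?size_tuple ?imset0 //.
by apply/subsetP => u; rewrite inE.
Qed.

Definition in_shortlist (I : instance n m) (f : {ffun 'I_n -> option 'I_m}) i :=
  if f i is Some u then u \in shortlist (tnth I i) else true.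

(** A shortlist that omits a neighbour has exactly [n] entries, and the other [n - 1] online
    vertices cannot occupy them all. *)
Lemma free_shortlist (I : instance n m) (f : {ffun 'I_n -> option 'I_m}) i u :
    u \in tnth I i -> u \notin shortlist (tnth I i) ->
  exists2 w, w \in shortlist (tnth I i) & forall j, j != i -> f j != Some w.
Proof.
move=> uN uS.
have szS : size (shortlist (tnth I i)) = n.
  rewrite size_take_min; apply/minn_idPl; rewrite leqNgt; apply: contra uS => lt_n.
  by rewrite /shortlist take_oversize ?mem_enum // ltnW.
pose used := pmap f (enum (predC1 i)).
have [/allP sub|] := boolP (all (mem used) (shortlist (tnth I i))).
  have := uniq_leq_size (take_uniq n (enum_uniq _)) sub.
  rewrite szS size_pmap => /leq_trans/(_ (count_size _ _)).
  rewrite -cardE cardC1 card_ord leqNgt prednK ?leqnn //.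
  exact: leq_ltn_trans (ltn_ord i).
move=> /allPn[w wS wU]; exists w => // j ji; apply: contra wU => /eqP fj.
by rewrite /= mem_pmap -fj map_f // mem_enum.
Qed.

(** Exchange argument: take an optimal matching with the most shortlisted edges; any other edge
    could be rerouted to a free shortlisted vertex. *)
Lemma opt_shortlist_matching (I : instance n m) :
  exists f, [/\ is_matching I f, opt I = msize f & forall i, in_shortlist I f i].
Proof.
have [f0 f0M f0E] := opt_matching I.
pose P f := is_matching I f && (msize f == opt I).
have Pf0 : P f0 by rewrite /P f0M f0E eqxx.
have [f /andP[fM /eqP fE] fmax] := arg_maxnP (fun f => #|in_shortlist I f|) Pf0.
exists f; split=> // i; apply/negPn/negP => fi.
have /andP[/forallP fN /forallP fI] := fM.
have := fi; rewrite /in_shortlist; have := fN i.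
case fiE: (f i) => [u|//] uN uS.
have [w wS wF] := free_shortlist f uN uS.
pose f' := [ffun j => if j == i then Some w else f j].
have f'i : f' i = Some w by rewrite ffunE eqxx.
have f'j j : j != i -> f' j = f j by rewrite ffunE => /negbTE ->.
have Pf' : P f'.
  apply/andP; split; last first.
    rewrite -fE; apply/eqP/eq_card => j; rewrite !inE.
    by have [->|ji] := eqVneq j i; rewrite ?f'i ?fiE ?f'j.
  apply/andP; split; apply/forallP => j.
    have [->|ji] := eqVneq j i; last by rewrite f'j.
    by rewrite f'i shortlist_sub.
  apply/forallP => j'; apply/implyP => /andP[].
  have [->|ji] := eqVneq j i; have [->|j'i] := eqVneq j' i; rewrite ?f'i ?f'j //.
  - by move=> _ /eqP fj; have := wF _ j'i; rewrite -fj eqxx.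
  - by move=> _ /eqP fj; have := wF _ ji; rewrite fj eqxx.
  - by move=> a b; have /forallP/(_ j') := fI j; rewrite a b.
have : #|in_shortlist I f'| <= #|in_shortlist I f| := fmax _ Pf'.
rewrite leqNgt => /negP; apply; apply: proper_card.
apply/properP; split; last by exists i; rewrite !unfold_in /in_shortlist ?f'i //= fiE.
apply/subsetP => j; rewrite !unfold_in /in_shortlist.
by have [->|ji] := eqVneq j i; rewrite ?f'i ?f'j.
Qed.

Lemma opt_rename (I : instance n m) : opt I <= opt (rename_instance I).
Proof.
have [f [/andP[_ /forallP fI] -> fS]] := opt_shortlist_matching I.
pose f' := [ffun i => omap (name I) (f i)].
have -> : msize f = msize f'.
  by apply: eq_card => i; rewrite !inE ffunE; case: (f i).
have seenf i u : f i = Some u -> u \in seen I.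
  by move=> fiE; have := fS i; rewrite /in_shortlist fiE; apply/mem_seen/mem_tnth.
apply: (leq_bigmax_cond (P := is_matching (rename_instance I))).
apply/andP; split; apply/forallP => i.
  rewrite ffunE tnth_map; have := fS i; rewrite /in_shortlist.
  by case: (f i) => //= u uS; apply: imset_f.
apply/forallP => j; apply/implyP; rewrite !ffunE => /andP[].
have /forallP/(_ j) := fI i.
case fiE: (f i) => [u|//]; case fjE: (f j) => [w|//] /= /implyP ij _.
move=> /eqP/Some_inj uw; apply: ij; apply/eqP; congr Some.
by apply: (name_inj _ _ _ uw); rewrite ?size_tuple ?(seenf _ _ fiE) ?(seenf _ _ fjE).
Qed.

End Reduction.

(** * One short list of level assignments for all instances of a given size *)

Section Family.
Local Open Scope ring_scope.
Variables (R : realFieldType) (K : nat) (g : nat -> R).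
Hypothesis K_gt0 : (0 < K)%N.
Hypothesis g_gt0 : forall c, 0 < g c.
Hypothesis g_mono : forall c d, (c <= d)%N -> g c <= g d.
Hypothesis g_last : g K = 1.
Hypothesis g_sum : forall c, (c <= K)%N -> K%:R * (g c - g 0%N) <= \sum_(j < c) g j.

(* Markov: the average of [run] is at least [(1 - g 0) opt], and [run <= opt]. *)
Lemma card_good_priorities n m (I : instance n m) r : r < 1 ->
  #|{ffun 'I_m -> 'I_K}|%:R * ((1 - g 0%N - r) / (1 - r)) <=
  #|[set s : {ffun 'I_m -> 'I_K} | r * (opt I)%:R <= (run (rank_alg s) I)%:R]|%:R.
Proof.
move=> r1; pose S : finType := {ffun 'I_m -> 'I_K}; set G : {set S} := [set s | _].
rewrite -/S.
have r1' : 0 < 1 - r by rewrite subr_gt0.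
rewrite mulrA ler_pdivrMr //.
have [opt0|opt_gt0] := posnP (opt I).
  rewrite (_ : G = setT) ?cardsT; last first.
    by apply/setP => s; rewrite !inE opt0 mulr0 ler0n.
  apply: ler_wpM2l => //; have := g_gt0 0; lra.
have o0 : 0 < (opt I)%:R :> R by rewrite ltr0n.
rewrite -(ler_pM2r o0).
have g_ge0 c : 0 <= g c := ltW (g_gt0 c).
have := sum_run_rank g_ge0 g_mono g_last g_sum I K_gt0.
suff : \sum_(s : S) (run (rank_alg s) I)%:R <=
       #|G|%:R * (1 - r) * (opt I)%:R + #|S|%:R * (r * (opt I)%:R).
  move=> le1 le2; have := le_trans le2 le1; lra.
rewrite -!sum1_card !natr_sum !mulr_suml [X in _ <= X + _]big_mkcond -big_split /=.
apply: ler_sum => s _; rewrite inE !mul1r; case: ifP => [_|/negbT].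
  by rewrite mulrBl mul1r subrK ler_nat run_rank_le_opt.
by rewrite -ltNge add0r => /ltW.
Qed.

(** There are [2 ^ ((n * n).+1 * n)] instances. Every [L] greedy choices more than halve the
    uncovered ones, so in the end fewer than one remains, hence none. *)
Lemma rank_family n r L : (0 < n)%N -> r < 1 ->
    (1 - (1 - g 0%N - r) / (1 - r)) ^+ L < 2%:R^-1 ->
  exists2 l : seq {ffun 'I_(n * n).+1 -> 'I_K}, size l = (L * ((n * n).+1 * n))%N &
    forall J : instance n (n * n).+1,
      has (fun s => r * (opt J)%:R <= (run (rank_alg s) J)%:R) l.
Proof.
move=> n0 r1; set p := _ / _ => pL.
have r1' : 0 < 1 - r by rewrite subr_gt0.
have p1 : p <= 1 by rewrite /p ler_pdivrMr // mul1r; have := g_gt0 0; lra.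
have [||l sl lP] := @greedy_cover R
   {ffun 'I_(n * n).+1 -> 'I_K} (instance n (n * n).+1)
   (fun s J => r * (opt J)%:R <= (run (rank_alg s) J)%:R) p
   (L * ((n * n).+1 * n)) _ p1.
- by rewrite card_ffun !card_ord expn_gt0 K_gt0.
- by move=> J; apply: card_good_priorities.
exists l => // J; apply/negPn/negP => Jl; move: lP; apply/negP; rewrite -ltNge.
apply: (@lt_le_trans _ _ 1); last first.
  by rewrite ler1n; apply/card_gt0P; exists J; rewrite inE.
rewrite card_tuple -[#|{set _}|]cardsT -powersetT card_powerset cardsT card_ord.
rewrite -expnM exprM natrX -exprMn exprn_ilt1 //.
- by rewrite muln_eq0 -lt0n n0.
- by rewrite mulr_ge0 // exprn_ge0 // subr_ge0.
- by rewrite -ltr_pdivlMr // mul1r.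
Qed.

Lemma rank_max_alg r L : r < 1 ->
    (1 - (1 - g 0%N - r) / (1 - r)) ^+ L < 2%:R^-1 ->
  forall n, exists F : forall m, seq (online_alg m),
    forall m, (size (F m) <= L * ((n * n).+1 * n))%N /\
    forall I : instance n m, r * (opt I)%:R <= (\max_(A <- F m) run A I)%:R.
Proof.
move=> r1 pL [|n].
  exists (fun m => [::]) => m; split=> // I.
  rewrite big_nil (_ : opt I = 0%N) ?mulr0 //.
  apply/eqP; rewrite -leqn0; apply/bigmax_leqP => f _.
  by rewrite /msize (leq_trans (max_card _)) // card_ord.
have [l sl lP] := rank_family (ltn0Sn n) r1 pL.
exists (fun m => map (fun s => lift_alg (rank_alg s)) l) => m.
rewrite size_map sl; split=> // I; rewrite big_map.
have /hasP[s sl' sP] := lP (rename_instance I).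
have run_le : (run (lift_alg (rank_alg s)) I <=
    \max_(t <- l) run (lift_alg (rank_alg t)) I)%N.
  exact: (leq_bigmax_seq (F := fun t => run (lift_alg (rank_alg t)) I)).
(* Passing from [opt I] to the larger renamed optimum needs [0 <= r]; for negative [r] the claim is
   trivial. *)
have [r0|r0] := leP 0 r; last first.
  by apply: le_trans (_ : 0 <= _) => //; rewrite mulr_le0_ge0 // ltW.
apply: le_trans (_ : _ <= (run (lift_alg (rank_alg s)) I)%:R) _; last first.
  by rewrite ler_nat.
by rewrite run_lift (le_trans _ sP) // ler_wpM2l // ler_nat opt_rename.
Qed.

End Family.

(** * Splitting and bounding runs of an arbitrary algorithm *)

Section Runs.
Variables (m : nat) (A : online_alg m).
Implicit Types (h s t : seq {set 'I_m}) (M : {set 'I_m}).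

Fixpoint matched_aux h M s : {set 'I_m} :=
  if s is N :: s' then
    let h' := rcons h N in
    matched_aux h' (if A h' is Some u then
                      if (u \in N) && (u \notin M) then u |: M else M
                    else M) s'
  else M.

Lemma run_aux_cat h M s t :
  run_aux A h M (s ++ t) =
  run_aux A h M s + run_aux A (h ++ s) (matched_aux h M s) t.
Proof.
elim: s h M => [|N s IH] h M /=; first by rewrite cats0.
rewrite -cat_rcons.
case: (A _) => [u|]; last exact: IH.
by case: ifP => _; rewrite IH.
Qed.

(** Adjacency is checked but availability is not, so this set bounds a run without tracking which
    vertices are matched. *)
Definition proposed h s : {set 'I_m} :=
  [set w | has (fun i => (w \in nth set0 s i) && (A (h ++ take i.+1 s) == Some w))
               (iota 0 (size s))].

Lemma run_aux_le_proposed h M s : run_aux A h M s <= #|proposed h s :\: M|.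
Proof.
elim: s h M => [//|N s IH] h M /=.
have sub w : w \in proposed (rcons h N) s -> w \in proposed h (N :: s).
  rewrite !inE => /hasP[i]; rewrite mem_iota add0n => ilt /= wP.
  apply/orP; right; apply/hasP; exists i.+1; first by rewrite mem_iota.
  by rewrite -cat_rcons.
have leI M' : M \subset M' ->
    #|proposed (rcons h N) s :\: M'| <= #|proposed h (N :: s) :\: M|.
  move=> /subsetP sM; apply/subset_leq_card/subsetP => w; rewrite !in_setD.
  by move=> /andP[wM /sub ->]; rewrite andbT; apply: contra wM; apply: sM.
case Au: (A _) => [u|]; last by apply: leq_trans (IH _ _) (leI _ _).
case: ifP => [/andP[uN uM]|_]; last by apply: leq_trans (IH _ _) (leI _ _).
apply: leq_ltn_trans (IH _ _) _; apply: proper_card; apply/properP; split.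
  apply/subsetP => w; rewrite !in_setD in_setU1 negb_or => /andP[/andP[_ ->]] /=.
  exact: sub.
exists u; last by rewrite !inE eqxx.
rewrite in_setD uM inE /=; apply/orP; left.
by rewrite uN take0 cats1 Au eqxx.
Qed.

End Runs.

Lemma card_ord_ltn N i : i <= N -> #|[pred k : 'I_N | k < i]| = i.
Proof. by move=> iN; rewrite -sum1_card (big_ord_narrow iN) sum1_card card_ord. Qed.

(** * Randomly permuted triangular blocks *)

Section Block.
Variables (m N : nat) (e : 'I_N -> 'I_m).
Hypothesis e_inj : injective e.
Variables (A : online_alg m) (h : seq {set 'I_m}).
Implicit Types (p : 'S_N).

(* The upper triangular instance of Karp, Vazirani and Vazirani. *)
Definition nbhd p (i : nat) : {set 'I_m} := [set e (p j) | j : 'I_N & i <= j].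
Definition block p : seq {set 'I_m} := mkseq (nbhd p) N.

Definition hit p (i : nat) (j : 'I_N) : bool :=
  A (h ++ take i.+1 (block p)) == Some (e (p j)).

Lemma size_block p : size (block p) = N. Proof. exact: size_mkseq. Qed.

(** The vertex at position [j] is adjacent only to arrivals [i <= j], so to be matched it must be
    hit by time [j]. *)
Lemma run_block_le M p :
  run_aux A h M (block p) <= \sum_(j < N) has (fun i => hit p i j) (iota 0 j.+1).
Proof.
apply: leq_trans (run_aux_le_proposed _ _ _ _) _.
apply: leq_trans (subset_leq_card (subsetDl _ _)) _.
pose H := [set j : 'I_N | has (fun i => hit p i j) (iota 0 j.+1)].
have sub : proposed A h (block p) \subset [set e (p j) | j in H].
  apply/subsetP => w; rewrite inE => /hasP[i]; rewrite mem_iota size_block add0n.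
  move=> /= iN /andP[]; rewrite nth_mkseq // => /imsetP[j ij ->] Aj.
  apply/imsetP; exists j => //; rewrite inE; apply/hasP; exists i => //.
  by move: ij; rewrite mem_iota add0n ltnS inE.
apply: leq_trans (subset_leq_card sub) _; apply: leq_trans (leq_imset_card _ _) _.
rewrite -sum1_card big_mkcond; apply: leq_sum => j _; rewrite inE.
by case: has.
Qed.

Lemma nbhd_tperm p (j k : 'I_N) (l : nat) : l <= j -> l <= k ->
  nbhd (tperm j k * p) l = nbhd p l.
Proof.
move=> lj lk.
have sub q : nbhd (tperm j k * q) l \subset nbhd q l.
  apply/subsetP => w /imsetP[x lx ->]; rewrite permM; apply: imset_f.
  by move: lx; rewrite !inE; case: tpermP => [->|->|].
apply/eqP; rewrite eqEsubset sub /= -{1}(mulKg (tperm j k) p) tpermV.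
exact: sub.
Qed.

Lemma hit_tperm p (i : nat) (j k : 'I_N) : i <= j -> i <= k ->
  hit (tperm j k * p) i j = hit p i k.
Proof.
move=> ij ik; rewrite /hit permM tpermL; congr (A (h ++ _) == _).
have iN : i.+1 <= N by apply: leq_ltn_trans (ltn_ord j).
rewrite /block /mkseq -!map_take take_iota; apply/eq_in_map => l.
rewrite (minn_idPl iN) mem_iota add0n ltnS => /= li.
by rewrite nbhd_tperm // (leq_trans li).
Qed.

(* The first [i.+1] neighbourhoods do not depend on how [p] orders the positions
   [>= i], so each of these [N - i] positions is equally likely to be the
   proposed one. *)
Lemma sum_hit_le (i : nat) (j : 'I_N) : i <= j ->
  (N - i) * \sum_p hit p i j <= #|'S_N|.
Proof.
move=> ij.
have -> : N - i = #|[pred k : 'I_N | i <= k]|.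
  have iN : i <= N by apply: leq_trans ij (ltnW (ltn_ord j)).
  rewrite -[X in X - _](card_ord N) -(cardC [pred k : 'I_N | k < i]).
  rewrite card_ord_ltn // addKn; apply: eq_card => k.
  by rewrite !inE -leqNgt.
rewrite -sum1_card big_distrl /=.
rewrite (eq_bigr (fun k => \sum_p hit p i k)); last first.
  move=> k ik; rewrite mul1n (reindex_inj (mulgI (tperm j k))) /=.
  by apply: eq_bigr => p _; rewrite hit_tperm.
rewrite exchange_big /= -sum1_card; apply: leq_sum => p _.
have [k kP|no] := pickP [pred k | hit p i k]; last first.
  by rewrite big1 // => k _; have := no k => /= ->.
rewrite big_mkcond (bigD1 k) //= big1 ?addn0.
  by case: ifP => _; case: hit.
move=> l lk; case: ifP => // _; apply/eqP; rewrite eqb0.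
apply: contra lk => /eqP hl; move: kP; rewrite /= /hit hl => /eqP[].
by move=> /e_inj /perm_inj ->.
Qed.

Local Open Scope ring_scope.
Variable R : realFieldType.

Lemma sum_triangle (f : nat -> R) J :
  \sum_(j < J) \sum_(i < j.+1) f i = \sum_(i < J) (J - i)%:R * f i.
Proof.
elim: J => [|J IH]; first by rewrite !big_ord0.
rewrite big_ord_recr /= IH big_ord_recr [RHS]big_ord_recr /= subSnn mul1r addrA.
congr (_ + _); rewrite -big_split; apply: eq_bigr => i _ /=.
by rewrite subSn ?(ltnW (ltn_ord i)) // -natr1 mulrDl mul1r.
Qed.

(** The last [a] positions are counted as always matched; position [j < N - a] is hit with
    probability at most [\sum_(i <= j) 1 / (N - i)]. The bound is about [N - a ln (N / a)], hence
    [(1 - 1/e) N] for [a] near [N / e]. *)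
Lemma sum_run_block a M : (0 < a <= N)%N ->
  \sum_p (run_aux A h M (block p))%:R <=
  #|'S_N|%:R * (N%:R - a%:R * \sum_(i < N - a) (a + i).+1%:R^-1) :> R.
Proof.
move=> /andP[a0 aN].
have le_run p : (run_aux A h M (block p) <=
    a + \sum_(j < N | j < N - a) \sum_(i < j.+1) hit p i j)%N.
  apply: leq_trans (run_block_le M p) _.
  rewrite (bigID (fun j : 'I_N => j < N - a)%N) [X in (_ <= X)%N]addnC.
  apply: leq_add; last first.
    apply: (@leq_trans (\sum_(j < N | ~~ (j < N - a)%N) 1)%N).
      by apply: leq_sum => j _; case: has.
    rewrite sum1_card -(leq_add2l (N - a)) subnK //.
    rewrite -{1}(card_ord_ltn (leq_subr a N)).
    by rewrite (cardC [pred j : 'I_N | (j < N - a)%N]) card_ord.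
  apply: leq_sum => j _; case: hasP => // -[i]; rewrite mem_iota add0n => /= ij hi.
  by rewrite (bigD1 (Ordinal ij)) //= hi.
have le_hit (j : 'I_N) (i : 'I_j.+1) : \sum_p (hit p i j)%:R <=
    #|'S_N|%:R * (N - i)%:R^-1 :> R.
  rewrite ler_pdivlMr ?ltr0n ?subn_gt0 ?(leq_trans (ltn_ord i)) //.
  by rewrite -natr_sum -natrM ler_nat mulnC sum_hit_le // -ltnS.
apply: (@le_trans _ _ (\sum_p (a%:R +
    \sum_(j < N | (j < N - a)%N) \sum_(i < j.+1) (hit p i j)%:R))).
  apply: ler_sum => p _; have := le_run p; rewrite -(ler_nat R) natrD natr_sum.
  by under eq_bigr do rewrite natr_sum.
rewrite big_split /= sumr_const -[a%:R *+ _]mulr_natl.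
rewrite exchange_big /=; under eq_bigr do rewrite exchange_big /=.
apply: (@le_trans _ _ (#|'S_N|%:R * a%:R +
    #|'S_N|%:R * \sum_(j < N - a) \sum_(i < j.+1) (N - i)%:R^-1)).
  apply: lerD; first by rewrite ler_wpM2r // ler_nat max_card.
  rewrite (big_ord_narrow (leq_subr a N)) mulr_sumr; apply: ler_sum => j _.
  rewrite mulr_sumr; apply: ler_sum => i _.
  exact: (le_hit (widen_ord (leq_subr a N) j)).
rewrite -mulrDr ler_wpM2l // (sum_triangle (fun i => (N - i)%:R^-1)).
(* Reversing the sum turns the denominators [N - i] into [a + i + 1]. *)
rewrite (reindex_inj rev_ord_inj) /= mulr_sumr.
have eq_term (i : 'I_(N - a)) :
    (N - a - (N - a - i.+1))%:R * (N - (N - a - i.+1))%:R^-1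
    = 1 - a%:R * (a + i).+1%:R^-1 :> R.
  have iN := ltn_ord i.
  have -> : (N - a - (N - a - i.+1) = i.+1)%N by lia.
  have -> : (N - (N - a - i.+1) = (a + i).+1)%N by lia.
  rewrite -addnS natrD; have : (a%:R + i.+1%:R) != 0 :> R.
    by rewrite -natrD pnatr_eq0 addnS.
  move: (i.+1%:R : R) => y nz; field; exact: nz.
under eq_bigr do rewrite eq_term.
rewrite sumrB sumr_const card_ord natrB //.
by rewrite le_eqVlt; apply/orP; left; apply/eqP; ring.
Qed.

End Block.

(** * Concatenating blocks *)

Section Potential.
Local Open Scope ring_scope.
Variable R : realFieldType.

(** Convexity: [z ^+ x] lies below its chord on [[0, N]]. So a bound on the mean matching size
    bounds the mean potential. *)
Lemma expr_chord (z : R) x N : 1 <= z -> (x <= N)%N ->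
  N%:R * (z ^+ x - 1) <= x%:R * (z ^+ N - 1).
Proof.
move=> z1; elim: N => [|N IH]; first by rewrite leqn0 => /eqP ->; rewrite !mul0r.
rewrite leq_eqVlt => /orP[/eqP -> //|]; rewrite ltnS => xN.
have step : z ^+ x - 1 <= x%:R * (z ^+ N * (z - 1)).
  rewrite subrX1 mulrC mulrA ler_wpM2r ?subr_ge0 //.
  rewrite mulr_natl -[x in _ *+ x]card_ord -sumr_const; apply: ler_sum => i _.
  by rewrite ler_weXn2l // (leq_trans _ xN) // ltnW.
have := IH xN; rewrite exprS -natr1; move: step; set u := z ^+ x; set v := z ^+ N.
set X := x%:R; set Y := N%:R; nra.
Qed.

Lemma run_aux_le_size m (A : online_alg m) h M s : (run_aux A h M s <= size s)%N.
Proof.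
elim: s h M => [//|N s IH] h M /=.
by case: (A _) => [u|]; [case: ifP => _|]; rewrite ?ltnS // leqW.
Qed.

(** The potential of each algorithm factors into the part earned on [h] and the part earned on the
    block. The chord bounds the mean of the latter over [p], so some [p] is no worse than average
    for the whole sum. *)
Lemma exists_block m N (e : 'I_N -> 'I_m) (L : seq (online_alg m)) h (z mu : R) :
    injective e -> (0 < N)%N -> 1 <= z ->
    (forall (A : online_alg m) M,
       \sum_p (run_aux A h M (block e p))%:R <= #|'S_N|%:R * (N%:R * mu)) ->
  exists p : 'S_N,
    \sum_(A <- L) z ^+ run_aux A [::] set0 (h ++ block e p) <=
    (\sum_(A <- L) z ^+ run_aux A [::] set0 h) * (1 + mu * (z ^+ N - 1)).
Proof.
move=> e_inj N0 z1 avg; apply: exists_le_average.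
  by apply/card_gt0P; exists 1%g.
have N0r : 0 < N%:R :> R by rewrite ltr0n.
rewrite exchange_big /= mulr_suml mulr_sumr; apply: ler_sum => A _.
rewrite mulrCA; under eq_bigr do rewrite run_aux_cat exprD.
rewrite -mulr_sumr ler_wpM2l ?exprn_ge0 ?(le_trans ler01) //.
rewrite -(ler_pM2l N0r); set M := matched_aux _ _ _ _.
apply: (@le_trans _ _ (\sum_(p : 'S_N)
   (N%:R + (run_aux A h M (block e p))%:R * (z ^+ N - 1)))).
  rewrite mulr_sumr; apply: ler_sum => p _.
  have := run_aux_le_size A h M (block e p); rewrite size_block => /(expr_chord z1).
  rewrite cat0s; lra.
rewrite big_split /= sumr_const -mulr_suml -mulr_natl.
have z0 : 0 <= z ^+ N - 1 by rewrite subr_ge0 exprn_ege1.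
have := ler_wpM2r z0 (avg A M); lra.
Qed.

(** The list [us] records a perfect matching; its entries below [N * b] leave fresh offline vertices
    for the next block. *)
Lemma exists_blocks N B (L : seq (online_alg (N * B).+1)) (z mu : R) b :
    (0 < N)%N -> 1 <= z -> 0 <= 1 + mu * (z ^+ N - 1) ->
    (forall (e : 'I_N -> 'I_(N * B).+1) h A M, injective e ->
       \sum_p (run_aux A h M (block e p))%:R <= #|'S_N|%:R * (N%:R * mu)) ->
    (b <= B)%N ->
  exists (s : seq {set 'I_(N * B).+1}) (us : seq 'I_(N * B).+1),
  [/\ all2 (fun (u : 'I_(N * B).+1) (V : {set 'I_(N * B).+1}) => u \in V) us s,
      uniq us, all (fun u : 'I_(N * B).+1 => u < N * b)%N us, size s = (N * b)%N &
      \sum_(A <- L) z ^+ run_aux A [::] set0 s <=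
      (size L)%:R * (1 + mu * (z ^+ N - 1)) ^+ b].
Proof.
move=> N0 z1 q0 avg; elim: b => [|b IH] bB.
  exists [::], [::]; split; rewrite ?muln0 //= expr0 mulr1.
  by rewrite big_const_seq count_predT iter_addr_0.
have [s [us [mus uus ltus szs le_s]]] := IH (ltnW bB).
pose e (i : 'I_N) : 'I_(N * B).+1 := inord (N * b + i).
have eE (i : 'I_N) : e i = (N * b + i)%N :> nat.
  rewrite inordK // ltnS; apply: leq_trans (leq_mul (leqnn N) bB).
  by rewrite mulnS addnC leq_add2r ltnW.
have e_inj : injective e.
  by move=> i j /(congr1 val); rewrite /= !eE => /addnI /val_inj.
have [p le_p] := exists_block L e_inj N0 z1 (fun A M => avg e s A M e_inj).
(* The new matching edges are the diagonal of the triangular block. *)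
exists (s ++ block e p), (us ++ [seq e (p i) | i <- enum 'I_N]).
split.
- rewrite all2E !size_cat size_block (size_map _ (enum _)) size_enum_ord.
  have szus : size us = size s by have := mus; rewrite all2E => /andP[/eqP].
  rewrite szus eqxx zip_cat //= all_cat.
  have := mus; rewrite all2E => /andP[_ ->] /=.
  rewrite /block /mkseq -val_enum_ord -map_comp zip_map all_map.
  by apply/allP => i _ /=; apply: imset_f; rewrite inE.
- rewrite cat_uniq uus /= map_inj_uniq ?enum_uniq; last first.
    by move=> i j /e_inj /perm_inj.
  rewrite andbT; apply/hasPn => _ /mapP[i _ ->]; apply/negP => /(allP ltus).
  by rewrite eE ltnNge leq_addr.
- rewrite all_cat; apply/andP; split.
    by apply: sub_all ltus => u /leq_trans; apply; rewrite leq_mul2l leqnSn orbT.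
  by apply/allP => _ /mapP[i _ ->]; rewrite eE mulnSr ltn_add2l.
- by rewrite size_cat szs size_block mulnSr.
- by apply: le_trans le_p _; rewrite exprSr mulrA ler_wpM2r.
Qed.

(** The summand [1] covers the empty list, whose maximum is [0]. *)
Lemma expr_bigmax_le m (L : seq (online_alg m)) (v : online_alg m -> nat) (z : R) :
  1 <= z -> z ^+ (\max_(A <- L) v A) <= 1 + \sum_(A <- L) z ^+ v A.
Proof.
move=> z1; have z0 k : 0 <= z ^+ k by rewrite exprn_ge0 // (le_trans ler01).
elim: L => [|A L IH]; first by rewrite !big_nil expr0 addr0.
rewrite !big_cons addrCA -[X in z ^+ X]/(maxn (v A) (\max_(A' <- L) v A')).
case: leqP => _; first by apply: le_trans IH _; rewrite lerDr.
by rewrite lerDl addr_ge0 // sumr_ge0.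
Qed.

Lemma hard_instance N a B (L : seq (online_alg (N * B).+1)) (z mu : R) :
    (0 < a <= N)%N -> 1 <= z -> 0 <= mu ->
    1 - (a%:R * \sum_(i < N - a) (a + i).+1%:R^-1) / N%:R <= mu ->
  exists I : instance (N * B) (N * B).+1, (N * B <= opt I)%N /\
    z ^+ (\max_(A <- L) run A I) <=
    1 + (size L)%:R * (1 + mu * (z ^+ N - 1)) ^+ B.
Proof.
move=> aN z1 mu0 le_mu.
have N0 : (0 < N)%N by case/andP: aN; apply: leq_trans.
have N0r : 0 < N%:R :> R by rewrite ltr0n.
have q0 : 0 <= 1 + mu * (z ^+ N - 1).
  by rewrite addr_ge0 // mulr_ge0 // subr_ge0 exprn_ege1.
have [|s [us [mus uus _ szs le_s]]] := exists_blocks L N0 z1 q0 _ (leqnn B).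
  move=> e h A M e_inj; apply: le_trans (sum_run_block e_inj A h R M aN) _.
  rewrite ler_wpM2l // -subr_ge0; have := ler_wpM2l (ltW N0r) le_mu.
  by rewrite mulrBr mulrCA mulfV ?gt_eqF // !mulr1 -subr_ge0.
have szus : size us = (N * B)%N.
  by have := mus; rewrite all2E szs => /andP[/eqP].
have /eqP szsE := szs; exists (Tuple szsE); split; last first.
  by apply: le_trans (expr_bigmax_le _ _ z1) _; rewrite lerD2l.
pose f := [ffun i : 'I_(N * B) => Some (nth ord0 us i)].
apply: (@leq_trans (msize f)).
  rewrite /msize (_ : [set i | _] = setT) ?cardsT ?card_ord //.
  by apply/setP => i; rewrite !inE ffunE.
apply: (leq_bigmax_cond (P := is_matching (Tuple szsE))).
apply/andP; split; apply/forallP => i.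
  rewrite ffunE (tnth_nth set0) /=; move: mus; rewrite all2E => /andP[_ /allP].
  move=> /(_ (nth (ord0, set0) (zip us s) i)); rewrite nth_zip ?szus //=.
  by apply; rewrite -nth_zip ?szus // mem_nth // size_zip szus szs minnn.
apply/forallP => j; apply/implyP; rewrite !ffunE => /andP[_ /eqP[]] /eqP.
by rewrite nth_uniq ?szus.
Qed.

End Potential.

(** * Geometric weights for the shares *)

Section GeometricShares.
Local Open Scope ring_scope.
Variables (R : realFieldType) (K : nat).

(** The weights [g c = x ^+ (K - c)] are a discrete [e^(t-1)]. With [x = K / (K+1)] one has
    [g c = K (g (c+1) - g c)], so the sum condition on [g] holds with equality. *)
Lemma rank_max_alg_geometric r L : (0 < K)%N -> r < 1 ->
    (1 - (1 - (K%:R / K.+1%:R) ^+ K - r) / (1 - r)) ^+ L < 2%:R^-1 ->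
  forall n, exists F : forall m, seq (online_alg m),
    forall m, (size (F m) <= L * ((n * n).+1 * n))%N /\
    forall I : instance n m, r * (opt I)%:R <= (\max_(A <- F m) run A I)%:R :> R.
Proof.
move=> K0; set x : R := K%:R / K.+1%:R.
have K1 : 0 < K.+1%:R :> R by rewrite ltr0n.
have x0 : 0 < x by rewrite divr_gt0 // ltr0n.
have x1 : x <= 1 by rewrite ler_pdivrMr // mul1r ler_nat.
have := @rank_max_alg R K (fun c => x ^+ (K - c)) K0 _ _ _ _ r L.
rewrite subn0; apply.
- by move=> c; rewrite exprn_gt0.
- by move=> c d cd; rewrite ler_wiXn2l ?leq_sub2l // ltW.
- by rewrite subnn.
move=> c; elim: c => [_|c IH cK]; first by rewrite big_ord0 subn0 subrr mulr0.
rewrite big_ord_recr /=; have := IH (ltnW cK).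
have -> : (K - c = (K - c.+1).+1)%N by lia.
rewrite exprS; set y := x ^+ (K - c.+1); set g0 := x ^+ _; set s := \sum_(_ < _) _.
suff : x * y = K%:R * y - K%:R * (x * y) by lra.
rewrite -mulrBr -{2}[y]mul1r -mulrBl /x -natr1.
have : (K%:R + 1) != 0 :> R by rewrite natr1 gt_eqF.
by move: (K%:R : R) => k nz; field; exact: nz.
Qed.

End GeometricShares.

From mathcomp Require Import Rstruct boolp.
(* From here on [%R] and [%N] denote Stdlib's [R_scope] and [N_scope]. *)
From Stdlib Require Import Reals.
From mathcomp Require Import ring lra.

(** * Estimates on the exponential *)

Section Exponential.
Local Delimit Scope ring_scope with ring.
Local Open Scope ring_scope.
Implicit Types x y eps : R.

Lemma exp_gt0 x : 0 < exp x.
Proof. by apply/RltP/exp_pos. Qed.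

Lemma exp_ge1D x : 1 + x <= exp x.
Proof. by apply/RleP; apply: exp_ineq1_le. Qed.

Lemma exp_le x y : x <= y -> exp x <= exp y.
Proof.
rewrite le_eqVlt => /orP[/eqP -> //|/RltP xy].
by apply/ltW/RltP/exp_increasing.
Qed.

Lemma exp_add x y : exp (x + y)%ring = exp x * exp y.
Proof. by rewrite expRD. Qed.

Lemma exp_mul1B_le x : exp x * (1 - x) <= 1.
Proof.
have expV : exp x * exp (- x) = 1.
  by rewrite expRD -[RHS]expR0; congr exp; apply: addrN.
by rewrite -[X in _ <= X]expV ler_wpM2l ?exp_ge1D // ltW ?exp_gt0.
Qed.

Lemma expV1 : exp (-1) * exp 1%ring = 1.
Proof. by rewrite expRD -[RHS]expR0; congr exp; apply: addNr. Qed.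

Lemma expV1_lt1 : exp (-1) < 1.
Proof.
have a0 := exp_gt0 (-1); rewrite -[X in _ < X]expV1 ltr_pMr //.
have e2 : 1 + 1 <= exp 1%ring := exp_ge1D 1%ring.
by apply: lt_le_trans e2; rewrite ltrDl.
Qed.

(** With [u = 1 / (K+1)], the power is at most [exp (- K u) = exp (-1) * exp u], and
    [exp u <= 1 / (1 - u) = 1 + 1 / K]. *)
Lemma ratio_pow_le (K : nat) : (0 < K)%nat ->
  (K%:R / K.+1%:R) ^+ K <= exp (-1) + K%:R^-1 :> R.
Proof.
move=> K0; have K0r : 0 < K%:R :> R by rewrite ltr0n.
have K1r : 0 < K.+1%:R :> R by rewrite ltr0n.
set u : R := K.+1%:R^-1.
have uE : K%:R * u = 1 - u.
  by rewrite /u -natr1 -[X in X - _](mulfV (lt0r_neq0 K1r)) -natr1; ring.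
have u0 : 0 < u by rewrite invr_gt0.
have le1 : (K%:R / K.+1%:R) ^+ K <= exp (- (K%:R * u))%ring.
  rewrite -[X in exp X]mulrN [X in exp X]mulr_natl -expRX.
  apply: lerXn2r; rewrite ?nnegrE ?divr_ge0 ?(ltW (exp_gt0 _)) //.
  by apply: le_trans (exp_ge1D _); rewrite -/u uE.
apply: le_trans le1 _; rewrite uE.
have -> : exp (- (1 - u))%ring = exp (-1) * exp u.
  by rewrite expRD opprB addrC.
have uK : u <= K%:R^-1 * (1 - u).
  by rewrite -uE mulrA mulVf ?mul1r // lt0r_neq0.
have := exp_mul1B_le u; have := exp_gt0 (-1); have := expV1_lt1.
set a := exp (-1) => a1 a0 h.
have u1 : 0 < 1 - u by rewrite -uE mulr_gt0.
rewrite -(ler_pM2r u1) mulrDl -mulrA.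
apply: (@le_trans _ _ a); first by rewrite ger_pMr.
have : a * u <= u by rewrite ger_pMl // ltW.
rewrite mulrBr mulr1; lra.
Qed.

Lemma expr_half_lt x : 0 <= x -> x < 1 -> exists L, x ^+ L < 2%:R^-1.
Proof.
move=> x0 x1.
have [||L LP] := pow_lt_1_zero x _ (2%:R^-1)%ring.
- by apply/RltP; rewrite RabsE ger0_norm.
- by apply/RltP; rewrite invr_gt0 ltr0n.
exists L; have /RltP := LP L (le_n L).
by rewrite RabsE RpowE ger0_norm // exprn_ge0.
Qed.

(** The quotient telescopes into factors [1 + 1 / (a + i + 1)], each at most
    [exp (1 / (a + i + 1))]. *)
Lemma exp_harmonic a J :
  (a + J).+1%:R / a.+1%:R <= exp (\sum_(i < J) (a + i).+1%:R^-1)%ring.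
Proof.
elim: J => [|J IH]; first by rewrite big_ord0 expR0 addn0 mulfV ?pnatr_eq0.
rewrite big_ord_recr /= exp_add.
apply: le_trans (ler_pM _ _ IH (exp_ge1D _)); rewrite ?divr_ge0 ?addr_ge0 ?invr_ge0 //.
have a1 : a.+1%:R != 0 :> R by rewrite pnatr_eq0.
have aJ : (a + J).+1%:R != 0 :> R by rewrite pnatr_eq0.
rewrite addnS -[(a + J).+2%:R]natr1; move: a1 aJ.
move: (a.+1%:R : R) ((a + J).+1%:R : R) => u v u0 v0.
rewrite le_eqVlt; apply/orP; left; apply/eqP.
by field; apply/andP.
Qed.

(** Taking [N] just above [e * a] brings the harmonic sum close to [1]; [a > 2 / eps] absorbs the
    rounding. *)
Lemma balanced_block eps : 0 < eps -> exists a N, (0 < a <= N)%nat /\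
  1 - (a%:R * \sum_(i < N - a) (a + i).+1%:R^-1) / N%:R <= 1 - exp (-1) + eps.
Proof.
move=> eps0.
set a := (Num.truncn (2%:R / eps)).+1.
have a_eps : 2%:R < a%:R * eps.
  by rewrite -ltr_pdivrMr // truncnS_gt.
have a0 : 0 < a%:R :> R by rewrite ltr0n.
set E := exp (-1); set e1 := exp 1%ring.
have E0 : 0 < E := exp_gt0 _.
have E1 : E < 1 := expV1_lt1.
have Ee : E * e1 = 1 := expV1.
have e0 : 0 < e1 := exp_gt0 _.
have e_gt1 : 1 < e1 by rewrite -Ee gtr_pMl.
set N := (Num.truncn (a%:R * e1)).+1.
have /andP[N_le N_gt] : N%:R <= a%:R * e1 + 1 < N%:R + 1.
  have /andP[le1 lt1] := truncn_itv (ltW (mulr_gt0 a0 e0)).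
  by rewrite /N -{1}natr1 lerD2r le1 ltrD2r.
have aN : (a <= N)%nat.
  rewrite -(ler_nat R) ltW //; rewrite ltrD2r in N_gt; apply: lt_trans N_gt.
  by rewrite ltr_pMr.
have N0 : 0 < N%:R :> R by rewrite ltr0n.
exists a, N; split; first by rewrite aN.
set h : R := \sum_(_ < _) _.
have h0 : 0 <= h by apply: sumr_ge0 => i _; rewrite invr_ge0.
have h1 : a%:R - 1 <= a%:R * h.
  have := exp_harmonic a (N - a); rewrite subnKC // -/h => le_h.
  have lt_h : a%:R * e1 <= exp h * a.+1%:R.
    rewrite -ler_pdivrMr ?ltr0n //; apply: le_trans le_h.
    by rewrite ler_wpM2r ?invr_ge0 // -natr1; lra.
  (* Together with [a e <= (a + 1) exp h] this gives [a (2 - h) <= a + 1], without logarithms. *)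
  have : (2%:R - h) * exp h <= e1.
    have -> : e1 = exp (1 - h)%ring * exp h by rewrite -exp_add subrK.
    apply: ler_wpM2r; first exact: ltW (exp_gt0 h).
    by apply: le_trans (exp_ge1D _); rewrite addrA.
  have := exp_gt0 h; move: lt_h; rewrite -natr1; set w := exp h => le1 w0 le2.
  rewrite -(ler_pM2r w0).
  have := ler_wpM2l (ltW a0) le2; lra.
suff : (E - eps) * N%:R <= a%:R * h.
  by rewrite -ler_pdivlMr //; lra.
have [neg|pos] := lerP (E - eps) 0.
  by apply: le_trans (_ : 0 <= _); rewrite ?mulr_ge0 ?mulr_le0_ge0 // ltW.
apply: le_trans (ler_wpM2l (ltW pos) N_le) _; apply: le_trans h1.
have : a%:R * eps <= a%:R * eps * e1 by rewrite ler_pMr ?ltW // mulr_gt0.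
have -> : (E - eps) * (a%:R * e1 + 1) =
          a%:R * (E * e1) + E - eps - a%:R * eps * e1 by ring.
rewrite Ee; lra.
Qed.

Lemma exp_le_quadratic x : 0 <= x -> x <= 2%:R^-1 -> exp x <= 1 + x + 2%:R * x ^+ 2.
Proof.
move=> x0 x2; have := exp_mul1B_le x; have x1 : 0 < 1 - x by lra.
move=> le1; rewrite -(ler_pM2r x1); apply: le_trans le1 _; nra.
Qed.

Lemma Rpower2_le_exp x : 0 <= x -> Rpower 2 x <= exp x.
Proof.
move=> x0; apply: exp_le; rewrite RmultE -[X in _ <= X]mulr1 ler_wpM2l //.
rewrite -[X in _ <= X](ln_exp 1); apply/ltW/RltP/ln_increasing.
  exact: Rlt_0_2.
exact: (exp_ineq1 1 R1_neq_R0).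
Qed.

(** * The two bounds over the reals *)

Lemma rank_achieves eps : 0 < eps -> exists L : nat,
  forall n, exists F : forall m, seq (online_alg m),
    forall m, (size (F m) <= L * ((n * n).+1 * n))%nat /\
    forall I : instance n m,
      (1 - exp (-1) - eps) * (opt I)%:R <= (\max_(A <- F m) run A I)%:R :> R.
Proof.
move=> eps0; set E := exp (-1); set r := 1 - E - eps.
have E0 : 0 < E := exp_gt0 _.
have r1 : r < 1 by rewrite /r; lra.
(* With [1 / K < eps] the mean ratio [1 - g 0] strictly exceeds [r], so a positive fraction of
   assignments is good and [L] depends on [eps] alone. *)
have [K K0 K_eps] : exists2 K : nat, (0 < K)%nat & K%:R^-1 < eps.
  exists (Num.truncn eps^-1).+1 => //.
  rewrite -[X in _ < X]invrK ltf_pV2 ?posrE ?invr_gt0 //.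
  exact: truncnS_gt.
have le_x := ratio_pow_le K0; rewrite -/E in le_x.
have x0 : 0 <= (K%:R / K.+1%:R) ^+ K :> R by rewrite exprn_ge0 ?divr_ge0.
have [||L LP] := @expr_half_lt (1 - (1 - (K%:R / K.+1%:R) ^+ K - r) / (1 - r))%ring.
- rewrite subr_ge0 ler_pdivrMr ?subr_gt0 // mul1r.
  by rewrite lerD2r lerBlDr lerDl.
- rewrite ltrBlDr ltrDl divr_gt0 ?subr_gt0 //.
  move: x0 le_x; rewrite /r; set y := _ ^+ K; lra.
by exists L; apply: rank_max_alg_geometric LP.
Qed.

(** With [z = exp (eta / N)], a ratio [r] would give [exp (eta r B) <= 1 + exp (u B)], where [u]
    collects the number of algorithms and the growth per block. Since [r] exceeds [mu] by [eps / 2],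
    a small [eta] makes [eta r] exceed [u] by [eta ^+ 2]. *)
Lemma no_subexp_ratio eps (F : max_alg) (k : nat -> nat) r :
  0 < eps -> subexp_bounded k -> uses_at_most F k -> 1 - exp (-1) + eps < r ->
  ~ forall n m (I : instance n m), r * (opt I)%:R <= (max_value F I)%:R.
Proof.
move=> eps0 kS Fk rE FP; set E := exp (-1) in rE.
have E0 : 0 < E := exp_gt0 _.
have E1 : E < 1 := expV1_lt1.
have eps2 : 0 < eps / 2%:R by rewrite divr_gt0.
have [a [N [aN block_le]]] := balanced_block eps2.
set mu := 1 - exp (-1) + eps / 2%:R in block_le; rewrite -/E in mu block_le.
have mu0 : 0 <= mu by rewrite /mu; lra.
have N0 : (0 < N)%nat by case/andP: aN; apply: leq_trans.
have N0r : 0 < N%:R :> R by rewrite ltr0n.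
(* The bound [1 / 8] allows the quadratic estimate of [exp eta]; [eps / 16] keeps the second-order
   terms below [eta * eps / 2]. *)
have [eta [eta0 eta8 eta16]] :
    exists eta : R, [/\ 0 < eta, eta <= 8%:R^-1 & eta <= eps / 16%:R].
  exists (Num.min 8%:R^-1 (eps / 16%:R)); split; last 2 first.
  - by rewrite ge_min lexx.
  - by rewrite ge_min lexx orbT.
  by rewrite lt_min invr_gt0 ltr0n divr_gt0.
have eta_sq : 0 < eta ^+ 2 by rewrite exprn_gt0.
(* At size [N * B] this rate allows at most [exp (eta ^+ 2 * B)] algorithms. *)
set d := eta ^+ 2 / N%:R; have d0 : 0 < d by rewrite divr_gt0.
have [n0 kP] := kS d (elimT RltP d0).
(* [B] must reach the range where the subexponential bound holds and make the final gap
   [eta ^+ 2 * B] exceed [1]. *)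
have [B n0B B_eta] : exists2 B, (n0 <= B)%nat & 1 < eta ^+ 2 * B%:R.
  exists (n0 + (Num.truncn (eta ^+ 2)^-1).+1)%nat; first exact: leq_addr.
  rewrite -ltr_pdivrMl // mulr1.
  by apply: lt_le_trans (truncnS_gt _) _; rewrite ler_nat leq_addl.
have B0 : 0 <= B%:R :> R by [].
set z := exp (eta / N%:R)%ring.
have zX (j : nat) : z ^+ j = exp (eta / N%:R * j%:R)%ring by rewrite expRX mulr_natr.
have zN : z ^+ N = exp eta by rewrite zX divfK // gt_eqF.
have z1 : 1 <= z.
  by apply: le_trans (exp_ge1D _); rewrite lerDl divr_ge0 // ltW.
have [I [optI maxI]] := @hard_instance R N a B (F (N * B)%nat (N * B).+1) z mu
  aN z1 mu0 block_le.
set u := eta ^+ 2 + mu * (eta + 2%:R * eta ^+ 2).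
have u0 : 0 <= u.
  apply: addr_ge0 (ltW eta_sq) (mulr_ge0 mu0 (addr_ge0 (ltW eta0) _)).
  by rewrite mulr_ge0 // ltW.
have gap : u + eta ^+ 2 <= eta * r.
  have : eta * mu <= eta * (r - eps / 2%:R) by rewrite ler_pM2l // /mu; lra.
  have : mu * eta ^+ 2 <= (1 + eps / 2%:R) * eta ^+ 2.
    by rewrite ler_pM2r // /mu; lra.
  have : eta * eta <= eta * (eps / 16%:R) by rewrite ler_pM2l.
  have : eps * eta * eta <= eps * eta * 8%:R^-1 by rewrite ler_pM2l // mulr_gt0.
  rewrite /u expr2; lra.
have size_le : (size (F (N * B)%nat (N * B).+1))%:R <= exp (eta ^+ 2 * B%:R)%ring.
  apply: le_trans (_ : (k (N * B)%nat)%:R <= _); first by rewrite ler_nat Fk.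
  have nB : (n0 <= N * B)%nat by apply: leq_trans n0B _; rewrite leq_pmull.
  have /RleP := kP _ nB; rewrite !INRE => /le_trans; apply.
  apply: le_trans (Rpower2_le_exp _) _; first by rewrite mulr_ge0 // ltW.
  by rewrite RmultE natrM mulrA /d divfK // gt_eqF.
have pow_le : (1 + mu * (z ^+ N - 1)) ^+ B <=
              exp (mu * (eta + 2%:R * eta ^+ 2) * B%:R)%ring.
  rewrite [X in exp X]mulr_natr -expRX lerXn2r ?nnegrE ?(ltW (exp_gt0 _)) //.
    by rewrite addr_ge0 // mulr_ge0 // subr_ge0 exprn_ege1.
  apply: le_trans (exp_ge1D _); rewrite lerD2l ler_wpM2l // zN lerBlDl addrA.
  by apply: exp_le_quadratic; [exact: ltW | lra].
have lower : exp (eta * r * B%:R)%ring <=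
             z ^+ (\max_(A <- F (N * B)%nat (N * B).+1) run A I).
  rewrite zX; apply: exp_le.
  have r0 : 0 <= r by lra.
  have := FP _ _ I; rewrite /max_value; set v := \max_(_ <- _) _ => le_v.
  have le_v' : r * (N%:R * B%:R) <= v%:R.
    by apply: le_trans le_v; rewrite ler_wpM2l // -natrM ler_nat.
  have -> : eta * r * B%:R = eta / N%:R * (r * (N%:R * B%:R)).
    by have := lt0r_neq0 N0r; move: (N%:R : R) => y y0; field.
  by rewrite ler_wpM2l // divr_ge0 // ltW.
have upper : exp (eta * r * B%:R)%ring <= 1 + exp (u * B%:R)%ring.
  apply: le_trans lower _; apply: le_trans maxI _; rewrite lerD2l.
  rewrite /u [X in exp X]mulrDl exp_add ler_pM // exprn_ge0 //.
  by rewrite addr_ge0 // mulr_ge0 // subr_ge0 exprn_ege1.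
(* For [w = exp (u B) >= 1] this yields [w (1 + eta ^+ 2 B) <= 1 + w], impossible when
   [eta ^+ 2 B > 1]. *)
have : exp (u * B%:R)%ring * (1 + eta ^+ 2 * B%:R) <= exp (eta * r * B%:R)%ring.
  apply: le_trans (_ : exp (u * B%:R)%ring * exp (eta ^+ 2 * B%:R)%ring <= _).
    by rewrite ler_wpM2l ?exp_ge1D // ltW ?exp_gt0.
  by rewrite -exp_add; apply: exp_le; rewrite -mulrDl ler_wpM2r.
have : 1 <= exp (u * B%:R)%ring.
  by apply: le_trans (exp_ge1D _); rewrite lerDl mulr_ge0.
move: upper; set w := exp (u * _)%ring => upper w1.
have : w * 1 < w * (eta ^+ 2 * B%:R) by rewrite ltr_pM2l // (lt_le_trans ltr01).
rewrite mulrDr; lra.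
Qed.

End Exponential.

Theorem theorem5 :
  (forall eps : R, (0 < eps)%R ->
     exists (F : max_alg) (k : nat -> nat),
       poly_bounded k /\ uses_at_most F k /\
       achieves_ratio F (1 - exp (-1) - eps)%R)
  /\
  (forall eps : R, (0 < eps)%R ->
     forall (F : max_alg) (k : nat -> nat),
       subexp_bounded k -> uses_at_most F k ->
       forall r : R, (1 - exp (-1) + eps < r)%R -> ~ achieves_ratio F r).
Proof.
split=> eps /RltP eps0.
  (* Choice assembles the lists obtained for each [n] into a single [max_alg]. *)
  have [L /choice[F FP]] := rank_achieves eps0.
  exists F, (fun n => L * ((n * n).+1 * n)); split; [|split].
  - exists (2 * L), 3 => -[|n]; first by rewrite !muln0.
    rewrite [2 * L]mulnC -mulnA leq_mul2l; apply/orP; right.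
    (* The [^] of [poly_bounded] is [Nat.pow], not [expn]. *)
    rewrite -[Nat.pow _ 3]/(n.+1 * (n.+1 * (n.+1 * 1))); nia.
  - by move=> n m; have [] := FP n m.
  - move=> n m I; apply/RleP; rewrite !INRE.
    by have [_] := FP n m; apply.
move=> F k kS Fk r /RltP rP FP; apply: (no_subexp_ratio eps0 kS Fk rP) => n m I.
by have /RleP := FP n m I; rewrite !INRE.
Qed.
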